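(* The eigenmeasure $\nu_\beta$ converges to $\nu_{top,1}$ in the weak* topology as $\beta\to+\infty$.
   Context: Fix integers $N\ge 2$, $p\ge 2$, a real $\theta\in(0,1)$, a real $\alpha>0$ and positive reals $\alpha_1,\dots,\alpha_{Np}$ such that for each $1\le j\le N$, $\alpha_{(j-1)p+1}<\alpha_{(j-1)p+2}\le\dots\le\alpha_{jp}$, and $\alpha_1<\alpha_{p+1}<\alpha_{2p+1}\le\dots\le\alpha_{(N-1)p+1}$ (for $N=2$ this reads $\alpha_1<\alpha_{p+1}$). Let $\Sigma=\{1,\dots,Np+1\}^{\mathbb N}$ with the one-sided shift $\sigma$ and the distance $d(x,y)=\theta^{\min\{n\ge0:\,x_n\ne y_n\}}$ ($d(x,x)=0$). Write $u:=Np+1$, $u_{ij}:=(j-1)p+i$ for $1\le i\le p$, $1\le j\le N$, $\mathcal A_j:=\{u_{1j},\dots,u_{pj}\}$, $\Sigma_j:=\mathcal A_j^{\mathbb N}\subset\Sigma$; $[w]$ is the cylinder of points starting with the word $w$. The potential $A:\Sigma\to\mathbb R$ is $A(x)=-\alpha_{(j-1)p+i}\,d(x,\Sigma_j)$ if $x\in[u_{ij}]$, and $A(x)=-\alpha$ if $x\in[u]$. For $\beta>0$ the transfer operator on continuous functions is $\mathcal L_\beta(\varphi)(x)=\sum_{a=1}^{Np+1}e^{\beta A(ax)}\varphi(ax)$; $e^{\mathcal P(\beta)}$ is its spectral radius, and $\nu_\beta$ is the unique probability measure with $\mathcal L_\beta^*\nu_\beta=e^{\mathcal P(\beta)}\nu_\beta$.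 $\nu_{top,1}$ is the eigen-probability of the dual transfer operator on $(\Sigma_1,\sigma)$ for the potential constantly $0$ (it gives mass $p^{-n}$ to each cylinder of $\Sigma_1$ defined by a word of length $n$ in the letters $\mathcal A_1$), viewed as a measure on $\Sigma$. *)

(* Defs.v *)
From HB Require Import structures.
From mathcomp Require Import all_boot all_order all_algebra.
From mathcomp Require Import complex zify.
From mathcomp Require Import all_classical all_reals all_analysis.

Set Implicit Arguments.
Unset Strict Implicit.
Unset Printing Implicit Defensive.

Import Order.TTheory GRing.Theory Num.Theory.
Import numFieldNormedType.Exports.

Local Open Scope classical_set_scope.
Local Open Scope ring_scope.

(* Non-emptiness (Pointed) is required by the library's measurable types. *)
#[short(type="alphabetType")]
HB.structure Definition Alphabet := {T of Finite T & Pointed T}.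

HB.instance Definition _ n := isPointed.Build 'I_n.+1 ord0.

(* The full one-sided shift T^nat, with the product of the discrete topologies
   (the topology of the distance [dist] below, see [nbhs_dist]) and its Borel
   sigma-algebra. *)
Definition shift_space (T : alphabetType) : Type :=
  prod_topology (fun _ : nat => discrete_topology T).

HB.instance Definition _ (T : alphabetType) := Topological.on (shift_space T).
HB.instance Definition _ (T : alphabetType) := Pointed.on (shift_space T).
HB.instance Definition _ (T : alphabetType) :=
  Measurable.copy (shift_space T) (g_sigma_algebraType (@open (shift_space T))).

Lemma nbhs_cylinder (T : alphabetType) (x : shift_space T)
    (U : set (shift_space T)) :
  nbhs x U <->
  exists n, [set y : shift_space T | forall k, (k <= n)%N -> y k = x k] `<=` U.
Proof.
split.
- pose F := filter_from [set: nat]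
    (fun n => [set y : shift_space T | forall k, (k <= n)%N -> y k = x k]).
  have FF : Filter F.
    apply: filter_from_filter; first by exists 0%N.
    move=> m n _ _; exists (maxn m n) => // y xy; split=> k kl; apply: xy.
      exact: leq_trans (leq_maxl _ _).
    exact: leq_trans (leq_maxr _ _).
  have : F --> x.
    apply/cvg_sup => i V /= [_ [[W _ <-] Wx] WV].
    exists i => // y /= /(_ i (leqnn i)) yx; apply: WV.
    by rewrite /= yx.
  by move=> /(_ U) + xU => /(_ xU) [n _ nU]; exists n.
- move=> [n nU]; apply: (filterS nU) => {nU}.
  have nk k : nbhs x [set y : shift_space T | y k = x k].
    exact: (@proj_continuous nat (fun=> discrete_topology T) k x [set x k]
      (discrete_set1 _)).
  elim: n => [|n IHn].
    by apply: filterS (nk 0%N) => y /= yx k; rewrite leqn0 => /eqP ->.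
  apply: filterS (filterI IHn (nk n.+1)) => y /= [yx yn] k.
  by rewrite leq_eqVlt => /predU1P[->//|/yx].
Qed.

Section Shift.
Variables (R : realType) (T : alphabetType).
Implicit Types (x y : shift_space T) (A : shift_space T -> R).

Definition prepend (a : T) x : shift_space T :=
  fun n => if n is m.+1 then x m else a.

(* d(x, y) = theta ^ min {n | x_n <> y_n}, and d(x, x) = 0. *)
Definition dist (theta : R) x y : R :=
  if pselect (exists n, x n != y n) is left h then theta ^+ ex_minn h else 0.

Definition dist_set (theta : R) x (S : set (shift_space T)) : R :=
  inf [set dist theta x y | y in S].

(* L_A phi (x) = sum_a e^{A(ax)} phi(ax), on real and on complex functions. *)
Definition transfer A (phi : shift_space T -> R) : shift_space T -> R :=
  fun x => \sum_(a : T) expR (A (prepend a x)) * phi (prepend a x).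

Definition transferC A (phi : shift_space T -> R[i]) : shift_space T -> R[i] :=
  fun x => \sum_(a : T)
    (real_complex R (expR (A (prepend a x)))) * phi (prepend a x).

(* C(T^nat; complex numbers) *)
Definition continuousC : set (shift_space T -> R[i]) :=
  [set phi | continuous (phi : shift_space T -> R[i]^o)].

(* On a Banach space, lambda - L is invertible as a bounded operator iff it is
   a bijection. *)
Definition spectrum A : set R[i] :=
  [set lambda | ~ set_bij continuousC continuousC
                    (fun phi x => lambda * phi x - transferC A phi x)].

Definition spectral_radius A : R :=
  sup [set ComplexField.Normc.normc lambda | lambda in spectrum A].

(* L_A^* nu = r nu with r the spectral radius of L_A, the dual operator acting
   on measures seen as linear forms on continuous functions. *)
Definition eigenprobability A (nu : probability (shift_space T) R) : Prop :=
  forall phi : shift_space T -> R, continuous phi ->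
    \int[nu]_x transfer A phi x = spectral_radius A * \int[nu]_x phi x.

(* nu beta --> m in the weak* topology, as beta --> +oo. *)
Definition weak_star_cvg (nu : R -> probability (shift_space T) R)
    (m : probability (shift_space T) R) : Prop :=
  forall phi : shift_space T -> R, continuous phi ->
    \int[nu beta]_x phi x @[beta --> +oo] --> \int[m]_x phi x.

Lemma dist_lt (theta : R) x y n : 0 < theta < 1 ->
  (dist theta x y < theta ^+ n) <-> (forall k, (k <= n)%N -> x k = y k).
Proof.
move=> /andP[t0 t1]; rewrite /dist; case: pselect => [h|h].
  case: ex_minnP => m xym mmin; rewrite ltr_iXn2l//; split=> [nm k kn|xy].
    apply/eqP; apply: contraT => /mmin; rewrite leqNgt => /negP; case.
    exact: leq_ltn_trans nm.
  by rewrite ltnNge; apply/negP => /xy xyE; rewrite xyE eqxx in xym.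
split=> _; last exact: exprn_gt0.
by move=> k _; apply/eqP; apply: contraT => xyk; case: h; exists k.
Qed.

Lemma nbhs_dist (theta : R) x (U : set (shift_space T)) : 0 < theta < 1 ->
  nbhs x U <-> exists2 e, 0 < e & [set y | dist theta x y < e] `<=` U.
Proof.
move=> t01; have /andP[t0 t1] := t01; rewrite nbhs_cylinder; split.
- move=> [n nU]; exists (theta ^+ n); first exact: exprn_gt0.
  by move=> y /= /(dist_lt _ _ _ t01) xy; apply: nU => k kn; rewrite xy.
- move=> [e e0 eU].
  have : theta ^+ n @[n --> \oo] --> (0 : R) by apply: cvg_expr; rewrite gtr0_norm.
  move=> /cvgrPdist_lt /(_ _ e0) [n _ /(_ n (leqnn n))].
  rewrite sub0r normrN gtr0_norm ?exprn_gt0// => ne.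
  exists n => y /= xy; apply: eU => /=; apply: lt_trans ne.
  by apply/dist_lt => // k /xy.
Qed.

End Shift.

(* The letters of A as an alphabet of their own; the proof A0 is an argument of
   the type so that a distinguished letter can be chosen. *)
Section SubAlphabet.
Variables (T : alphabetType) (A : {set T}) (A0 : A != finset.set0).

Definition subalphabet : Type := let _ := A0 in {a : T | a \in A}.
HB.instance Definition _ := Finite.copy subalphabet {a : T | a \in A}.

Let subalphabet_point : subalphabet :=
  let A0' := @set0Pn _ A A0 in exist _ (xchoose A0') (xchooseP A0').
HB.instance Definition _ := isPointed.Build subalphabet subalphabet_point.

Definition inclusion (x : shift_space subalphabet) : shift_space T :=
  fun n => sval (x n).

Lemma inclusion_continuous : continuous inclusion.
Proof.
move=> x U /nbhs_cylinder [n nU]; apply/nbhs_cylinder; exists n => y /= xy.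
by apply: nU => k /xy; rewrite /inclusion => ->.
Qed.

Lemma measurable_inclusion : measurable_fun setT inclusion.
Proof.
apply: (@measurability _ _ _ _ _ _ (@open (shift_space T))) => //.
move=> _ [U oU <-]; rewrite setTI; apply: sub_sigma_algebra.
by move/continuousP: inclusion_continuous; exact.
Qed.

HB.instance Definition _ :=
  isMeasurableFun.Build _ _ _ _ inclusion measurable_inclusion.

(* A measure on A^nat viewed as a measure on T^nat. *)
Definition extend_measure (R : realType)
    (m : probability (shift_space subalphabet) R) :
    probability (shift_space T) R := distribution m inclusion.

End SubAlphabet.

Section Model.
Variables N p : nat.

(* The letters 1, ..., Np+1 are encoded by 'I_(N * p).+1, the ordinal a standing
   for the letter a.+1; thus u = Np+1 is ord_max and u_ij = (j-1)p+i is the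
   ordinal of value (j-1)p+i-1, for 1 <= i <= p and 1 <= j <= N. *)
Definition letter : alphabetType := 'I_(N * p).+1.

(* A_j *)
Definition block (j : nat) : {set letter} :=
  [set a : letter | ((j - 1) * p + 1 <= a.+1 <= j * p)%N]%SET.

(* Sigma_j = A_j^nat, as a subset of Sigma *)
Definition Sigma_ (j : nat) : set (shift_space letter) :=
  [set x | forall n, x n \in block j].

(* For a < N * p, the block index j of the letter a.+1 is (a %/ p).+1. *)
Definition potential (R : realType) (theta alpha : R) (al : nat -> R)
    (x : shift_space letter) : R :=
  if x 0%N == ord_max then - alpha
  else - al (x 0%N).+1 * dist_set theta x (Sigma_ (x 0%N %/ p).+1).

Lemma potentialE (R : realType) (theta alpha : R) (al : nat -> R)
    (x : shift_space letter) (i j : nat) :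
  (1 <= i <= p)%N -> (1 <= j <= N)%N -> (x 0%N).+1 = ((j - 1) * p + i)%N ->
  potential theta alpha al x =
    - al ((j - 1) * p + i)%N * dist_set theta x (Sigma_ j).
Proof.
move=> /andP[i0 ip] /andP[j0 jN] xij; rewrite /potential -xij.
have xE : nat_of_ord (x 0%N) = ((j - 1) * p + (i - 1))%N.
  by apply: succn_inj; rewrite xij -addnS; congr addn; case: (i) i0 => //= k _; lia.
have xlt : (nat_of_ord (x 0%N) < N * p)%N.
  rewrite xE; apply: (@leq_trans (j * p)); last by rewrite leq_mul2r; lia.
  by case: (j) j0 => //= k _; rewrite mulSn; lia.
rewrite (_ : (x 0%N == _) = false); last first.
  by apply/eqP => x0; move: xlt; rewrite x0 /= ltnn.
congr (- _ * dist_set _ _ (Sigma_ _)).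
by rewrite xE divnMDl ?divn_small; lia.
Qed.

Lemma block1_neq0 : (2 <= N)%N -> (2 <= p)%N -> block 1 != finset.set0.
Proof.
by move=> N2 p2; apply/set0Pn; exists ord0; rewrite inE subnn mul0n mul1n /=; lia.
Qed.

(* A_1 as an alphabet, so that Sigma_1 as a dynamical system of its own is
   [shift_space letter1]. *)
Definition letter1 (hN : (2 <= N)%N) (hp : (2 <= p)%N) : alphabetType :=
  subalphabet (block1_neq0 hN hp).

End Model.

(* Main.v *)
Require Import Defs.
From HB Require Import structures.
From mathcomp Require Import all_boot all_order all_algebra.
From mathcomp Require Import zify ring lra.
From mathcomp Require Import all_classical all_reals all_analysis.

Set Implicit Arguments.
Unset Strict Implicit.
Unset Printing Implicit Defensive.

Import Order.TTheory GRing.Theory Num.Theory.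
Import numFieldNormedType.Exports.

Local Open Scope classical_set_scope.
Local Open Scope ring_scope.

(* Fix beta and let nu = nu_beta, with eigenvalue r. Let E(j, n) be the set of
   points whose first n letters, but not the next one, are in A_j. Since
   d(ax, Sigma_j) = theta^(n+1) for a in A_j and x in E(j, n), the equation
   L^* nu = r nu gives
     r nu(E(j, n+1)) = S_j(theta^(n+1)) nu(E(j, n)),
     S_j(t) = sum_(a in A_j) e^(- beta alpha_a t).
   If r <= p these masses would be bounded below, so r > p, Sigma_j is null and
   nu[A_j] is the sum of the nu(E(j, n)) over n >= 1. For j >= 2 compare the
   products S_j(theta) .. S_j(theta^n) and S_1(theta) .. S_1(theta^n): the first
   factor gains e^(- beta delta theta), with delta = alpha_(p+1) - alpha_1, each
   factor loses at most p, and the factors beyond some m independent of beta lose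
   together at most e^(beta delta theta / 2). Hence, with c the mass of the
   complement of [A_1], c nu[A_j] <= eps := p^m e^(- beta delta theta / 2), and
   c^2 <= N eps + nu[u] tends to 0.
   Finally let K phi(x) = sum_(a in A_1) phi(ax). The measure nu_(top,1) is
   invariant under p^-1 K^*, so that p^-n K^n phi tends uniformly to its integral
   against nu_(top,1), while A <= 0 and r > p bound the integral against nu of a
   nonnegative phi over n-cylinders of A_1 by that of p^-n K^n phi.
   No spectral theory is needed: the spectral radius enters only as the
   eigenvalue of nu, and p is the eigenvalue of nu_(top,1) on constants. *)

(** * Continuous functions on the shift *)

Section ShiftSpace.
Variables (R : realType) (T : alphabetType).
Implicit Types (x y : shift_space T) (f g : shift_space T -> R).

Lemma continuous_finite_dependence f n :
  (forall x y, (forall k, (k <= n)%N -> y k = x k) -> f y = f x) ->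
  continuous f.
Proof.
move=> fn x U /nbhs_singleton Ux; apply/nbhs_cylinder; exists n => y /= xy.
by rewrite (fn x y).
Qed.

Lemma shift_space_compact : compact [set: shift_space T].
Proof.
have fT : finite_set [set: discrete_topology T] := @finite_finset T setT.
have := tychonoff (fun _ : nat => finite_compact fT).
by congr (compact _); apply/seteqP.
Qed.

Lemma uniform_continuity f (e : R) : continuous f -> 0 < e ->
  exists n, forall x y, (forall k, (k < n)%N -> y k = x k) -> `|f x - f y| <= e.
Proof.
move=> cf e0.
pose P (n : nat) x :=
  forall y, (forall k, (k < n)%N -> y k = x k) -> `|f x - f y| <= e.
have /compact_near_coveringP/(_ _ \oo P _) := shift_space_compact.
case=> [x _|n _ nP]; last by exists n => x y; apply: (nP n (leqnn n) x).
have /cvgrPdist_le /(_ (e / 2)) := cf x.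
case/(_ (divr_gt0 e0 (ltr0Sn _ 1)))/nbhs_cylinder => n nf.
(* If [y] is in the cylinder of [x] and [z] agrees with [y] on more than [n] letters, then both are
   in that cylinder, where [f] is within [e / 2] of [f x]. *)
exists ([set y | forall k, (k <= n)%N -> y k = x k], [set m | (n < m)%N]).
  split=> /=; first by apply/nbhs_cylinder; exists n.
  by exists n.+1.
move=> [y m] /= [xy nm] z yz.
apply: le_trans (ler_distD (f x) _ _) _; rewrite distrC [e]splitr lerD//.
  exact: nf.
by apply: nf => k kn; rewrite yz ?xy//; exact: leq_ltn_trans nm.
Qed.

Lemma continuous_bounded f : continuous f -> exists K, forall x, `|f x| <= K.
Proof.
move=> cf.
have /compact_bounded [K [_ /(_ (K + 1))]] : compact (f @` setT).
  by apply: continuous_compact shift_space_compact; exact: continuous_subspaceT.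
rewrite ltrDl ltr01 => /(_ isT) fK; exists (K + 1) => x; apply: fK; exact: imageT.
Qed.

Lemma continuous_measurable f : continuous f -> measurable_fun setT f.
Proof.
move=> /continuousP cf.
apply: (measurability _ (measurable_realfun.RGenOpens.measurableE R)).
move=> _ [_ [a [b ->] <-]]; rewrite setTI; apply: sub_sigma_algebra.
exact/cf/interval_open.
Qed.

Variable m : probability (shift_space T) R.

Lemma continuous_integrable f : continuous f -> m.-integrable setT (EFin \o f).
Proof.
move=> cf; have [K fK] := continuous_bounded cf.
apply: measurable_bounded_integrable => //.
- by rewrite (le_lt_trans (probability_le1 m measurableT))// ltry.
- exact: continuous_measurable.
- exists K; split; first exact: num_real.
  by move=> L KL x _; exact: le_trans (fK x) (ltW KL).
Qed.

Lemma integralD_continuous f g : continuous f -> continuous g ->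
  \int[m]_x (f x + g x) = \int[m]_x f x + \int[m]_x g x.
Proof. by move=> cf cg; rewrite RintegralD//; exact: continuous_integrable. Qed.

Lemma integralB_continuous f g : continuous f -> continuous g ->
  \int[m]_x (f x - g x) = \int[m]_x f x - \int[m]_x g x.
Proof. by move=> cf cg; rewrite RintegralB//; exact: continuous_integrable. Qed.

Lemma integralZ_continuous (c : R) f : continuous f ->
  \int[m]_x (c * f x) = c * \int[m]_x f x.
Proof. by move=> cf; rewrite RintegralZl//; exact: continuous_integrable. Qed.

Lemma Rintegral_prob_cst (c : R) : \int[m]_x (cst c x) = c.
Proof.
rewrite Rintegral_cst// -[RHS]mulr1.
exact: (congr1 (fun z => c * fine z) (probability_setT m)).
Qed.

Lemma le_integral_continuous f g : continuous f -> continuous g ->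
  (forall x, f x <= g x) -> \int[m]_x f x <= \int[m]_x g x.
Proof.
by move=> cf cg fg; apply: le_Rintegral => //; exact: continuous_integrable.
Qed.

Lemma continuous_sum (I : Type) (s : seq I) (P : pred I)
    (F : I -> shift_space T -> R) :
  (forall i, continuous (F i)) -> continuous (fun x => \sum_(i <- s | P i) F i x).
Proof.
move=> cF; elim: s => [|i s IHs].
  by under eq_fun do rewrite big_nil; exact: cst_continuous.
under eq_fun do rewrite big_cons.
case: (P i); last exact: IHs.
by move=> x; exact: (continuousD (cF i x) (IHs x)).
Qed.

Lemma integral_sum_continuous (I : Type) (s : seq I) (P : pred I)
    (F : I -> shift_space T -> R) : (forall i, continuous (F i)) ->
  \int[m]_x (\sum_(i <- s | P i) F i x) = \sum_(i <- s | P i) \int[m]_x F i x.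
Proof.
move=> cF; elim: s => [|i s IHs].
  rewrite big_nil -[RHS](Rintegral_prob_cst 0); apply: eq_Rintegral => x _.
  by rewrite big_nil.
rewrite big_cons -IHs; case: ifP => Pi; last first.
  by apply: eq_Rintegral => x _; rewrite big_cons Pi.
rewrite -integralD_continuous//; last exact: continuous_sum.
by apply: eq_Rintegral => x _; rewrite big_cons Pi.
Qed.

(* No measurability of [f] is required, so that it applies to [transfer A phi]
   without any regularity of [A]. *)
Lemma ge0_le_Rintegral f g : (forall x, 0 <= f x <= g x) -> continuous g ->
  \int[m]_x f x <= \int[m]_x g x.
Proof.
move=> fg cg.
have f0 x : 0 <= f x by have /andP[] := fg x.
have g0 x : 0 <= g x by have /andP[/le_trans] := fg x; apply.
(* For nonnegative functions the integral is a supremum over the simple functions below, which is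
   monotone without measurability. *)
have lefg : (\int[m]_x (f x)%:E <= \int[m]_x (g x)%:E)%E.
  rewrite !ge0_integralE; try by move=> x _; rewrite lee_fin.
  apply: le_ereal_sup => _ [h /= hf <-]; exists h => //= x.
  apply: le_trans (hf x) _; rewrite !patch_setT lee_fin.
  by have /andP[] := fg x.
(* [fine] sends infinite values to 0, so it preserves the order only between finite ones. *)
have gfin : (\int[m]_x (g x)%:E)%E \is a fin_num.
  exact: integrable_fin_num (continuous_integrable cg).
apply: fine_le => //.
rewrite ge0_fin_numE; last by apply: integral_ge0 => x _; rewrite lee_fin.
by apply: le_lt_trans lefg _; rewrite ltey_eq gfin.
Qed.

Lemma prepend_continuous (a : T) : continuous (@prepend T a).
Proof.
move=> x U /nbhs_cylinder [n nU]; apply/nbhs_cylinder; exists n => y /= xy.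
by apply: nU => -[|k] //= /ltnW/xy.
Qed.

End ShiftSpace.

(** * Points whose first letters are in a given set *)

Section Stays.
Variables (R : realType) (T : alphabetType) (B : {set T}).
Implicit Types (x y : shift_space T) (phi : shift_space T -> R).

(** Boolean, so that [(stays n x)%:R] is an indicator function, continuous and hence admissible in
    the eigenvalue equation. *)
Definition stays n x := all (fun k => x k \in B) (iota 0 n).

Lemma stays_prepend n a x : stays n.+1 (prepend a x) = (a \in B) && stays n x.
Proof. by rewrite /stays /= (iotaDl 1 0) all_map; congr andb; exact: eq_all. Qed.

Lemma staysS n x : stays n.+1 x = stays n x && (x n \in B).
Proof. by rewrite /stays -[n.+1]addn1 iotaD all_cat /= andbT. Qed.

Lemma staysP n x : reflect (forall k, (k < n)%N -> x k \in B) (stays n x).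
Proof.
apply: (iffP allP) => xB k; first by move=> kn; apply: xB; rewrite mem_iota.
by rewrite mem_iota => /andP[_]; exact: xB.
Qed.

Lemma eq_stays n x y : (forall k, (k < n)%N -> y k = x k) -> stays n y = stays n x.
Proof. by move=> xy; apply: eq_in_all => k; rewrite mem_iota => /xy ->. Qed.

Lemma stays_continuous n : continuous (fun x => (stays n x)%:R : R).
Proof.
apply: (@continuous_finite_dependence _ _ _ n) => x y xy.
by rewrite (@eq_stays n x y)// => k /ltnW/xy.
Qed.

Lemma stays_mul_continuous n phi : continuous phi ->
  continuous (fun x => (stays n x)%:R * phi x).
Proof.
by move=> cphi x; exact: (continuousM (@stays_continuous n x) (cphi x)).
Qed.

(** The operator K of the overview: the transfer operator of the zero potential on the subshift over
    [B], acting on functions on the whole shift. *)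
Definition branch_sum phi x := \sum_(a in B) phi (prepend a x).

Lemma branch_sum_continuous phi : continuous phi -> continuous (branch_sum phi).
Proof.
move=> cphi; apply: continuous_sum => a x.
exact: (continuous_comp (@prepend_continuous T a x) (cphi _)).
Qed.

Lemma iter_branch_sum_continuous n phi : continuous phi ->
  continuous (iter n branch_sum phi).
Proof. by move=> cphi; elim: n => //= n IHn; exact: branch_sum_continuous. Qed.

Lemma iter_branch_sum_cst n (c : R) x :
  iter n branch_sum (cst c) x = c * #|B|%:R ^+ n.
Proof.
elim: n x => [|n IHn] x; first by rewrite mulr1.
rewrite iterS /branch_sum; under eq_bigr do rewrite IHn.
by rewrite sumr_const exprSr mulrA mulr_natr.
Qed.

Lemma branch_sum_ge0 phi : (forall x, 0 <= phi x) -> forall x, 0 <= branch_sum phi x.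
Proof. by move=> phi0 x; apply: sumr_ge0. Qed.

(** The iterate sums [phi] over the words of length [n] in [B] put before the point, and two points
    with the same word before them agree on [n] letters. *)
Lemma iter_branch_sum_oscillation n phi (e : R) :
  (forall x y, (forall k, (k < n)%N -> y k = x k) -> `|phi x - phi y| <= e) ->
  forall x y, `|iter n branch_sum phi x - iter n branch_sum phi y| <=
    e * #|B|%:R ^+ n.
Proof.
elim: n phi e => [|n IHn] phi e osc x y; first by rewrite mulr1; exact: osc.
(* The induction runs on [branch_sum phi], which oscillates by at most [e * #|B|] on shorter
   cylinders. *)
rewrite !iterSr exprS mulrA; apply: IHn => {}x {}y xy.
rewrite /branch_sum -sumrB (le_trans (ler_norm_sum _ _ _))//.
rewrite mulr_natr -sumr_const ler_sum// => a _.
by apply: osc => -[|k] //= kn; exact: xy.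
Qed.

(** Only the branches by letters of [B] survive and [stays] loses one letter, which turns the
    eigenvalue equation into a recursion on [n]. *)
Lemma transfer_stays (A : shift_space T -> R) n phi x :
  transfer A (fun y => (stays n.+1 y)%:R * phi y) x =
  (stays n x)%:R * \sum_(a in B) expR (A (prepend a x)) * phi (prepend a x).
Proof.
rewrite /transfer mulr_sumr [RHS]big_mkcond; apply: eq_bigr => a _.
by rewrite stays_prepend; case: (a \in B); rewrite ?mul0r ?mulr0//= mulrCA.
Qed.

Variables (m : probability (shift_space T) R) (A : shift_space T -> R) (r : R).
Hypothesis eigen : forall phi, continuous phi ->
  \int[m]_x transfer A phi x = r * \int[m]_x phi x.

Definition stay_mass n : R := \int[m]_x (stays n x)%:R.

Lemma stay_mass0 : stay_mass 0 = 1.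
Proof. exact: (Rintegral_prob_cst m 1). Qed.

Lemma stay_mass_ge0 n : 0 <= stay_mass n.
Proof. by apply: Rintegral_ge0. Qed.

Lemma stay_massS_le n : stay_mass n.+1 <= stay_mass n.
Proof.
apply: le_integral_continuous; try exact: stays_continuous.
by move=> x; rewrite staysS ler_nat; case: stays; case: (_ \in _).
Qed.

(** Masses of exit sets are handled as such differences, whose sums telescope. *)
Lemma stay_massB n :
  stay_mass n - stay_mass n.+1 = \int[m]_x (stays n x && (x n \notin B))%:R.
Proof.
rewrite -integralB_continuous; try exact: stays_continuous.
apply: eq_Rintegral => x _; rewrite staysS.
by case: stays; case: (_ \in _); rewrite ?subrr ?subr0.
Qed.

(** Each use of the eigenvalue equation trades a factor [r] for one branch sum, the weights
    [expR (A _)] being at most 1. As [A] need not be measurable, integrals are compared by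
    [ge0_le_Rintegral]. *)
Lemma integral_stays_le n phi : 0 <= r ->
  (forall a x, a \in B -> A (prepend a x) <= 0) ->
  continuous phi -> (forall x, 0 <= phi x) ->
  r ^+ n * \int[m]_x ((stays n x)%:R * phi x) <=
    \int[m]_x iter n branch_sum phi x.
Proof.
move=> r0 A0; elim: n phi => [|n IHn] phi cphi phi0.
  by rewrite mul1r; under eq_Rintegral do rewrite mul1r.
rewrite exprSr -mulrA -eigen; last exact: stays_mul_continuous.
rewrite iterSr; apply: le_trans (IHn _ (branch_sum_continuous cphi) _); last first.
  exact: branch_sum_ge0.
apply: ler_wpM2l; first exact: exprn_ge0.
apply: ge0_le_Rintegral; last first.
  by apply: stays_mul_continuous; exact: branch_sum_continuous.
move=> x; rewrite transfer_stays; apply/andP; split.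
  by rewrite mulr_ge0// sumr_ge0// => a _; rewrite mulr_ge0// expR_ge0.
apply: ler_wpM2l => //; apply: ler_sum => a aB.
by rewrite ler_piMl// -expR0 ler_expR A0.
Qed.

(** When [r] exceeds [#|B|], this forces geometric decay, so the subshift over [B] is null. *)
Lemma stay_mass_le n : 0 <= r ->
  (forall a x, a \in B -> A (prepend a x) <= 0) ->
  r ^+ n * stay_mass n <= #|B|%:R ^+ n.
Proof.
move=> r0 A0.
have := @integral_stays_le n (cst 1) r0 A0 (@cst_continuous _ _ _) (fun=> ler01).
under eq_Rintegral do rewrite mulr1.
under [leRHS]eq_Rintegral do rewrite iter_branch_sum_cst mul1r.
by rewrite Rintegral_prob_cst.
Qed.

(** The equation is tested on the indicator of the exit set at time [n.+1], whose points are the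
    [prepend a x] with [a] in [B] and [x] in the exit set at time [n]. *)
Lemma exit_mass_eigen n (c : R) :
  (forall x, stays n x -> x n \notin B ->
     \sum_(a in B) expR (A (prepend a x)) = c) ->
  r * (stay_mass n.+1 - stay_mass n.+2) = c * (stay_mass n - stay_mass n.+1).
Proof.
move=> Ac; rewrite !stay_massB.
have cexit k : continuous (fun x => (stays k x && (x k \notin B))%:R : R).
  apply: (@continuous_finite_dependence _ _ _ k) => x y xy.
  by rewrite (xy k)// (@eq_stays k x y)// => i /ltnW/xy.
rewrite -eigen// -integralZ_continuous//; apply: eq_Rintegral => x _.
transitivity (transfer A (fun y => (stays n.+1 y)%:R * (y n.+1 \notin B)%:R) x).
  by apply: eq_bigr => a _; rewrite -natrM mulnb.
rewrite transfer_stays /= -mulr_suml.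
case: (boolP (stays n x)) => xn; last by rewrite mul0r mulr0.
by case: (boolP (x n \in B)) => xB; rewrite ?mulr0// Ac// mul1r mulr1.
Qed.

End Stays.

(** * The potential on exit sets *)

Section DistanceToSubshift.
Variables (R : realType) (T : alphabetType) (theta : R).
Implicit Types (x y : shift_space T) (S : set (shift_space T)).

Lemma dist_ge0 x y : 0 < theta -> 0 <= dist theta x y.
Proof.
by move=> t0; rewrite /dist; case: pselect => // h; rewrite exprn_ge0// ltW.
Qed.

Lemma dist_set_ge0 x S : 0 < theta -> 0 <= dist_set theta x S.
Proof.
move=> t0; rewrite /dist_set.
(* The infimum of the empty set is 0 by convention. *)
have [->|/set0P E0] := eqVneq [set dist theta x y | y in S] set0.
  by rewrite inf0.
by apply: lb_le_inf => // _ [y _ <-]; exact: dist_ge0.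
Qed.

(** A point with all letters in [B] differs from [x] at index [n.+1] at the latest, and some such
    point differs no earlier. *)
Lemma dist_set_exit (B : {set T}) n x : 0 < theta < 1 ->
  stays B n.+1 x -> x n.+1 \notin B ->
  dist_set theta x [set y : shift_space T | forall k, y k \in B] = theta ^+ n.+1.
Proof.
move=> t01 /staysP xB xn; have /andP[t0 t1] := t01.
(* [z] follows [x] as long as [x] stays in [B], then repeats the letter [x 0], which is in [B]. *)
pose z : shift_space T := fun k => if (k < n.+1)%N then x k else x 0%N.
have zB : [set y : shift_space T | forall k, y k \in B] z.
  by move=> k; rewrite /z; case: ifP => [/xB//|_]; exact: xB.
apply/eqP; rewrite eq_le; apply/andP; split.
  have zx : dist theta x z <= theta ^+ n.+1.
    rewrite /dist; case: pselect => [h|_]; last by rewrite exprn_ge0// ltW.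
    case: ex_minnP => k xzk _; rewrite ler_iXn2l// leqNgt.
    by apply: contra xzk => kn; rewrite /z kn.
  apply: le_trans zx; apply: ge_inf; last by exists z.
  by exists 0 => _ [y _ <-]; exact: dist_ge0.
apply: lb_le_inf; first by exists (dist theta x z), z.
move=> _ [y yB <-]; rewrite leNgt; apply/negP => /(dist_lt _ _ _ t01).
by move=> /(_ n.+1 (leqnn _)) xy; move: xn; rewrite xy yB.
Qed.

End DistanceToSubshift.

(** * The blocks of letters *)

Section Blocks.
Variables (N p : nat) (p_ge2 : (2 <= p)%N).

(** Block 0 is empty whereas [0.-1] is 0, hence the condition on [j]. *)
Lemma mem_block j (a : letter N p) : (0 < j)%N ->
  (a \in block N p j) = (a %/ p == j.-1)%N.
Proof.
case: j => // j _; rewrite inE subn1 /= addn1 ltnS mulSn addnC.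
rewrite eqn_leq andbC leq_divRL; last by lia.
by rewrite -[in RHS]ltnS ltn_divLR ?mulSn 1?addnC//; lia.
Qed.

Lemma block_lt j (a : letter N p) : (1 <= j <= N)%N -> a \in block N p j ->
  (a < N * p)%N.
Proof.
move=> /andP[j1 jN]; rewrite inE => /andP[_ /leq_trans]; apply.
by rewrite leq_mul2r jN orbT.
Qed.

Lemma card_block j : (1 <= j <= N)%N -> #|block N p j| = p.
Proof.
move=> /andP[j1 jN].
have jp : (j.-1 * p + p <= N * p)%N by rewrite addnC -mulSn leq_mul2r; lia.
pose f (i : 'I_p) : letter N p := inord (j.-1 * p + i).
have fE i : nat_of_ord (f i) = (j.-1 * p + i)%N.
  by rewrite inordK//; have := ltn_ord i; lia.
have f_inj : injective f.
  by move=> i k /(congr1 (@nat_of_ord _)); rewrite !fE => /addnI/val_inj.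
rewrite -[RHS]card_ord -(card_imset _ f_inj); apply: eq_card => a.
rewrite mem_block//; apply/eqP/imsetP => [ap|[i _ ->]]; last first.
  by rewrite fE divnMDl ?divn_small ?addn0//; lia.
have amod : (a %% p < p)%N by rewrite ltn_mod; lia.
exists (Ordinal amod) => //; apply: val_inj.
by rewrite [RHS]fE /= -ap -divn_eq.
Qed.

Lemma letter_cases (a : letter N p) :
  a = ord_max \/ exists2 j, (1 <= j <= N)%N & a \in block N p j.
Proof.
have [aN|Na] := ltnP a (N * p); [right|left].
  exists (a %/ p).+1; last by rewrite mem_block.
  by rewrite /= ltn_divLR//; lia.
apply: val_inj => /=; apply/eqP; rewrite eqn_leq Na andbT -ltnS; exact: ltn_ord.
Qed.

End Blocks.

Section Potential.
Variables (R : realType) (N p : nat) (p_ge2 : (2 <= p)%N).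
Variables (theta alpha : R) (al : nat -> R).
Hypothesis theta01 : 0 < theta < 1.
Hypothesis al_gt0 : forall k, (1 <= k <= N * p)%N -> 0 < al k.

Let theta_gt0 : 0 < theta. Proof. by case/andP: theta01. Qed.

Lemma potential_block j (a : letter N p) x : (1 <= j <= N)%N ->
  a \in block N p j ->
  potential theta alpha al (prepend a x) =
  - al a.+1 * dist_set theta (prepend a x) (Sigma_ j).
Proof.
move=> j1N aj; rewrite /potential /=.
have -> : (a == ord_max) = false.
  by apply/negbTE; rewrite -val_eqE/= neq_ltn (block_lt j1N aj).
have j0 : (0 < j)%N by case/andP: j1N.
by move: aj; rewrite mem_block// => /eqP ->; rewrite prednK.
Qed.

Lemma al_letter_gt0 j (a : letter N p) : (1 <= j <= N)%N ->
  a \in block N p j -> 0 < al a.+1.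
Proof. by move=> j1N aj; apply: al_gt0; exact: (block_lt j1N aj). Qed.

Lemma potential_block_le0 j (a : letter N p) x : (1 <= j <= N)%N ->
  a \in block N p j -> potential theta alpha al (prepend a x) <= 0.
Proof.
move=> j1N aj; rewrite (potential_block x j1N aj) mulNr oppr_le0.
by rewrite mulr_ge0 ?dist_set_ge0// ltW// (al_letter_gt0 j1N aj).
Qed.

(** Prepending [a] adds one letter to the stay in the block, hence the exponent [n.+1]. *)
Lemma potential_exit j n (a : letter N p) x : (1 <= j <= N)%N ->
  a \in block N p j -> stays (block N p j) n x -> x n \notin block N p j ->
  potential theta alpha al (prepend a x) = - (al a.+1 * theta ^+ n.+1).
Proof.
move=> j1N aj xs xn; rewrite (potential_block x j1N aj) mulNr.
by rewrite -(@dist_set_exit _ _ theta (block N p j) n (prepend a x))//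
  stays_prepend aj.
Qed.

End Potential.

(** * Comparison of mass sequences *)

Section Sequences.
Variable R : realType.

(** The first factor gains [E], the factors up to index [m] lose at most [p] each, and the losses of
    the later ones telescope to at most [expR (d m.+1)]. *)
Lemma prod_ratio_le (p : nat) (w v d : nat -> R) (E : R) (m n : nat) :
  (0 < p)%N -> 0 <= E -> (forall k, 0 <= d k) ->
  (forall k, 0 <= w k) -> (forall k, 0 <= v k) ->
  w 0%N <= p%:R * E * v 0%N -> (forall k, w k <= p%:R * v k) ->
  (forall k, w k <= expR (d k - d k.+1) * v k) ->
  \prod_(k < n.+1) w k <=
    p%:R ^+ m.+1 * E * expR (d m.+1) * \prod_(k < n.+1) v k.
Proof.
move=> p0 E0 d0 w0 v0 w00 wp wd.
have p1 : 1 <= p%:R :> R by rewrite ler1n.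
have V0 k : 0 <= \prod_(i < k) v i by apply: prodr_ge0.
have W0 k : 0 <= \prod_(i < k) w i by apply: prodr_ge0.
have first_bound k :
    \prod_(i < k.+1) w i <= p%:R ^+ k.+1 * E * \prod_(i < k.+1) v i.
  elim: k => [|k IHk]; first by rewrite !big_ord1.
  rewrite big_ord_recr [in leRHS]big_ord_recr /=.
  apply: le_trans (ler_pM (W0 _) (w0 _) IHk (wp _)) _.
  by rewrite [p%:R ^+ k.+2]exprSr le_eqVlt; apply/orP; left; apply/eqP; ring.
(* For [n <= m] the crude bound suffices, since the additional powers of [p] and [expR (d m.+1)] are
   at least 1. *)
have [nm|mn] := leqP n m.
  apply: le_trans (first_bound n) _; apply: ler_wpM2r => //.
  rewrite -[leLHS]mulr1; apply: ler_pM => //.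
  - by rewrite mulr_ge0// exprn_ge0// ler0n.
  - by apply: ler_wpM2r => //; apply: ler_weXn2l.
  - by rewrite -expR0 ler_expR.
have tail_bound i : \prod_(k < (m + i).+1) w k <=
    p%:R ^+ m.+1 * E * expR (d m.+1 - d (m + i).+1) * \prod_(k < (m + i).+1) v k.
  elim: i => [|i IHi]; first by rewrite addn0 subrr expR0 mulr1.
  rewrite addnS big_ord_recr [in leRHS]big_ord_recr /=.
  apply: le_trans (ler_pM (W0 _) (w0 _) IHi (wd _)) _.
  rewrite (_ : d m.+1 - d (m + i).+2 =
    (d m.+1 - d (m + i).+1) + (d (m + i).+1 - d (m + i).+2)); last by ring.
  rewrite [in leRHS]expRD le_eqVlt; apply/orP; left; apply/eqP; ring.
rewrite -(subnKC (ltnW mn)); apply: le_trans (tail_bound _) _.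
apply: ler_wpM2r => //; apply: ler_wpM2l.
  by rewrite mulr_ge0// exprn_ge0// ler0n.
by rewrite ler_expR gerBl.
Qed.

(** The exponents telescope to [d n - d 0], where [d n] is nonnegative. *)
Lemma prod_ge_telescope (p : nat) (w d : nat -> R) n : (forall k, 0 <= d k) ->
  (forall k, p%:R * expR (d k.+1 - d k) <= w k) ->
  p%:R ^+ n * expR (- d 0%N) <= \prod_(k < n) w k.
Proof.
move=> d0 wd; apply: (@le_trans _ _ (p%:R ^+ n * expR (d n - d 0%N))).
  by rewrite ler_wpM2l ?exprn_ge0// ler_expR lerDr.
elim: n => [|n IHn]; first by rewrite subrr expR0 big_ord0 mulr1.
rewrite big_ord_recr /=.
have e0 k l : 0 <= p%:R ^+ k * expR l :> R by rewrite mulr_ge0 ?expR_ge0 ?exprn_ge0.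
apply: le_trans _ (ler_pM (e0 n _) (e0 1%N _) IHn (wd n)).
rewrite expr1 (_ : d n.+1 - d 0%N = (d n - d 0%N) + (d n.+1 - d n)); last by ring.
rewrite [in leLHS]expRD exprSr le_eqVlt; apply/orP; left; apply/eqP; ring.
Qed.

Lemma iter_ratio_prod (u w : nat -> R) (r : R) n :
  (forall n, r * (u n.+1 - u n.+2) = w n * (u n - u n.+1)) ->
  r ^+ n * (u n - u n.+1) = (u 0%N - u 1%N) * \prod_(k < n) w k.
Proof.
move=> ur; elim: n => [|n IHn]; first by rewrite big_ord0 mulr1 mul1r.
by rewrite big_ord_recr /= exprSr -mulrA ur mulrCA IHn; ring.
Qed.

Lemma not_bounded_mulrn (c K : R) : 0 < c -> ~ (forall n, c *+ n <= K).
Proof.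
move=> c0 cK; have := cK (Num.truncn (K / c)).+1.
by rewrite leNgt -mulr_natr mulrC -ltr_pdivrMr// truncnS_gt.
Qed.

(** If [r <= p], the differences [u n - u n.+1] stay above a positive constant, although their sums
    are at most [u 0]. *)
Lemma decr_ratio_gt (p : nat) (u w d : nat -> R) (r : R) :
  (0 < p)%N -> 0 < r -> (forall k, 0 <= d k) -> (forall n, 0 <= u n) ->
  u 1%N < u 0%N ->
  (forall n, r * (u n.+1 - u n.+2) = w n * (u n - u n.+1)) ->
  (forall k, p%:R * expR (d k.+1 - d k) <= w k) ->
  p%:R < r.
Proof.
move=> p0 r0 d0 u0 u10 ur wd; rewrite ltNge; apply/negP => rp.
pose c := (u 0%N - u 1%N) * expR (- d 0%N).
have c0 : 0 < c by rewrite mulr_gt0 ?expR_gt0 ?subr_gt0.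
have uc n : c <= u n - u n.+1.
  have pn : 0 < r ^+ n by rewrite exprn_gt0.
  rewrite -(ler_pM2l pn) (iter_ratio_prod _ ur) /c mulrCA.
  apply: ler_wpM2l; first by rewrite subr_ge0 ltW.
  apply: le_trans _ (prod_ge_telescope n d0 wd).
  apply: ler_wpM2r; first exact: expR_ge0.
  by rewrite lerXn2r ?nnegrE ?ler0n ?(ltW r0).
apply: (@not_bounded_mulrn c (u 0%N)) => // n.
apply: (@le_trans _ _ (u 0%N - u n)); last by rewrite gerBl.
elim: n => [|n IHn]; first by rewrite subrr.
by rewrite mulrS; have := uc n; lra.
Qed.

(* Divided by [r ^+ n], the products [w 0 * .. * w n.-1] are the ratios
   [(u n - u n.+1) / (u 0 - u 1)], so that they sum to [u 1 / (u 0 - u 1)]. *)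
Lemma mass_comparison (p : nat) (r eps : R) (u v w z : nat -> R) :
  0 <= eps -> p%:R < r -> u 0%N = 1 -> v 0%N = 1 ->
  (forall n, 0 <= u n) -> (forall n, 0 <= v n) ->
  u 1%N <= u 0%N -> v 1%N <= v 0%N ->
  (forall n, r ^+ n * u n <= p%:R ^+ n) ->
  (forall n, r * (u n.+1 - u n.+2) = w n * (u n - u n.+1)) ->
  (forall n, r * (v n.+1 - v n.+2) = z n * (v n - v n.+1)) ->
  (forall n, 0 <= z n) ->
  (forall n, \prod_(k < n.+1) w k <= eps * \prod_(k < n.+1) z k) ->
  (1 - v 1%N) * u 1%N <= eps.
Proof.
move=> eps0 pr uE vE u0 v0 u10 v10 urp ur vr z0 wz.
have r0 : 0 < r by apply: le_lt_trans pr; exact: ler0n.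
rewrite uE in u10; rewrite vE in v10.
(* The factor [1 - v 1] on the left is the initial exit mass of [v]; that of [u] is bounded by 1. *)
have step n :
    (1 - v 1%N) * (u n.+1 - u n.+2) <= eps * (v n.+1 - v n.+2).
  have rn : 0 < r ^+ n.+1 by rewrite exprn_gt0.
  rewrite -(ler_pM2l rn) mulrCA (iter_ratio_prod _ ur) [leRHS]mulrCA.
  rewrite (iter_ratio_prod _ vr) uE vE [leRHS]mulrCA.
  apply: ler_wpM2l; first by rewrite subr_ge0.
  have Z0 : 0 <= eps * \prod_(k < n.+1) z k by rewrite mulr_ge0// prodr_ge0.
  apply: le_trans (ler_wpM2l _ (wz n)) _; first by rewrite subr_ge0.
  by rewrite ler_piMl// gerBl.
have sum_step n : (1 - v 1%N) * (u 1%N - u n.+1) <= eps * (v 1%N - v n.+1).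
  elim: n => [|n IHn]; first by rewrite !subrr !mulr0.
  have := step n; move: IHn; rewrite !mulrBr => *; lra.
(* The remainder [u n.+1] of the telescoped sum is at most [(p / r) ^ n.+1], which tends to 0. *)
have bound n : (1 - v 1%N) * u 1%N <= eps + (p%:R / r) ^+ n.+1.
  have un : u n.+1 <= (p%:R / r) ^+ n.+1.
    by rewrite expr_div_n ler_pdivlMr ?exprn_gt0// mulrC.
  have a1 : (1 - v 1%N) * u n.+1 <= u n.+1 by rewrite ler_piMl// gerBl.
  have a2 : eps * (v 1%N - v n.+1) <= eps.
    by rewrite ler_piMr//; have := v0 n.+1; lra.
  by have := sum_step n; rewrite mulrBr; lra.
apply/ler_addgt0Pr => e e0.
have q0 : 0 <= p%:R / r by rewrite divr_ge0// ltW.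
have : (p%:R / r) ^+ n @[n --> \oo] --> (0 : R).
  by apply: cvg_expr; rewrite ger0_norm// ltr_pdivrMr// mul1r.
move=> /cvgrPdist_le /(_ _ e0) [n _ /(_ n.+1 (leqnSn n))].
rewrite sub0r normrN ger0_norm ?exprn_ge0// => ne.
by apply: le_trans (bound n) _; rewrite lerD2l.
Qed.

End Sequences.

(** * Eigenmeasures at finite temperature *)

Section EigenMeasure.
Variables (R : realType) (N p : nat) (N_ge2 : (2 <= N)%N) (p_ge2 : (2 <= p)%N).
Variables (theta alpha : R) (al : nat -> R).
Hypothesis theta01 : 0 < theta < 1.
Hypothesis al_gt0 : forall k, (1 <= k <= N * p)%N -> 0 < al k.
Hypothesis al_block_lt : forall j, (1 <= j <= N)%N ->
  al ((j - 1) * p + 1)%N < al ((j - 1) * p + 2)%N.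
Hypothesis al_block_le : forall j i, (1 <= j <= N)%N -> (2 <= i < p)%N ->
  al ((j - 1) * p + i)%N <= al ((j - 1) * p + i.+1)%N.
Hypothesis al_first_lt1 : al 1%N < al (p + 1)%N.
Hypothesis al_first_lt2 : (2 < N)%N -> al (p + 1)%N < al (2 * p + 1)%N.
Hypothesis al_first_le : forall j, (2 <= j)%N -> (j.+1 < N)%N ->
  al (j * p + 1)%N <= al (j.+1 * p + 1)%N.

Let theta_gt0 : 0 < theta. Proof. by case/andP: theta01. Qed.
Let theta_lt1 : theta < 1. Proof. by case/andP: theta01. Qed.

Let p_gt0 : (0 < p)%N. Proof. exact: ltnW. Qed.

Let block1N : (1 <= 1 <= N)%N. Proof. by rewrite /= ltnW. Qed.

Lemma al_block_ge_first j (a : letter N p) : (1 <= j <= N)%N ->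
  a \in block N p j -> al ((j - 1) * p + 1)%N <= al a.+1.
Proof.
move=> j1N; rewrite inE => /andP[ja aj].
have [i [i0 ip ->]] : exists i, [/\ (1 <= i)%N, (i <= p)%N &
    (a.+1 = (j - 1) * p + i)%N].
  exists (a.+1 - (j - 1) * p)%N.
  by move: ja aj; case: (j) j1N => // k _; rewrite !subn1 /= mulSn => *; split; lia.
elim: i i0 ip => // -[|[|i]] IHi _ ip //; first exact/ltW/al_block_lt.
by apply: le_trans (IHi _ _) (al_block_le _ _) => //; exact: ltnW.
Qed.

Lemma al_later_ge j (a : letter N p) : (2 <= j <= N)%N ->
  a \in block N p j -> al (p + 1)%N <= al a.+1.
Proof.
move=> /andP[j2 jN] aj.
have j1N : (1 <= j <= N)%N by rewrite jN andbT ltnW.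
apply: le_trans _ (al_block_ge_first j1N aj).
case: j j2 jN {aj j1N} => [|[|j]] // _; rewrite subn1 /=.
elim: j => [|[|j] IHj] jN; first by rewrite mul1n.
- exact/ltW/al_first_lt2.
- by apply: le_trans (IHj (ltnW jN)) (al_first_le _ _).
Qed.

(** Any common upper bound of the coefficients would serve; their sum is one by positivity. *)
Let al_max := \sum_(k < N * p) al k.+1.

Lemma al_le_max j (a : letter N p) : (1 <= j <= N)%N ->
  a \in block N p j -> al a.+1 <= al_max.
Proof.
move=> j1N aj; have aN := block_lt j1N aj.
rewrite /al_max (bigD1 (Ordinal aN))//= lerDl sumr_ge0// => i _.
by apply/ltW/al_gt0; rewrite /= ltn_ord.
Qed.

Let al_max_ge0 : 0 <= al_max.
Proof. by apply: sumr_ge0 => i _; apply/ltW/al_gt0; rewrite /= ltn_ord. Qed.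

(** * Weights of the blocks *)

Section Weights.
Variable b : R.
Hypothesis b_gt0 : 0 < b.

(** The sum S_j(t) of the overview at inverse temperature [b]. *)
Definition block_weight j (t : R) :=
  \sum_(a in block N p j) expR (b * - (al a.+1 * t)).

Lemma block_weight_ge0 j t : 0 <= block_weight j t.
Proof. by apply: sumr_ge0 => a _; exact: expR_ge0. Qed.

Lemma block_weight_le j (c t : R) : (1 <= j <= N)%N -> 0 <= t ->
  (forall a : letter N p, a \in block N p j -> c <= al a.+1) ->
  block_weight j t <= p%:R * expR (b * - (c * t)).
Proof.
move=> j1N t0 ca; rewrite -(card_block p_ge2 j1N) mulr_natl -sumr_const.
apply: ler_sum => a aj; rewrite ler_expR ler_pM2l// lerN2.
by rewrite ler_wpM2r// ca.
Qed.

Lemma block_weight_le_card j (t : R) : (1 <= j <= N)%N -> 0 <= t ->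
  block_weight j t <= p%:R.
Proof.
move=> j1N t0; have -> : p%:R = p%:R * expR (b * - (0 * t)) :> R.
  by rewrite mul0r oppr0 mulr0 expR0 mulr1.
by apply: block_weight_le => // a aj; exact/ltW/(al_letter_gt0 al_gt0 j1N aj).
Qed.

Lemma block_weight_ge j (c t : R) : (1 <= j <= N)%N -> 0 <= t ->
  (forall a : letter N p, a \in block N p j -> al a.+1 <= c) ->
  p%:R * expR (b * - (c * t)) <= block_weight j t.
Proof.
move=> j1N t0 ca; rewrite -(card_block p_ge2 j1N) mulr_natl -sumr_const.
apply: ler_sum => a aj; rewrite ler_expR ler_pM2l// lerN2.
by rewrite ler_wpM2r// ca.
Qed.

Lemma block_weight1_ge t : expR (b * - (al 1%N * t)) <= block_weight 1 t.
Proof.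
have o1 : (ord0 : letter N p) \in block N p 1.
  by rewrite (mem_block p_ge2)//= div0n.
by rewrite /block_weight (bigD1 _ o1) /= lerDl sumr_ge0.
Qed.

(** The [p] terms of block [j] have coefficients at least [al (p + 1)], while block 1 contains the
    term with coefficient [al 1]. *)
Lemma block_weight_le_block1 j (t : R) : (2 <= j <= N)%N -> 0 <= t ->
  block_weight j t <=
  p%:R * expR (b * - ((al (p + 1)%N - al 1%N) * t)) * block_weight 1 t.
Proof.
move=> j2N t0; have j1N : (1 <= j <= N)%N by case/andP: j2N => /ltnW ->.
apply: le_trans (block_weight_le j1N t0 _) _.
  by move=> a; exact: al_later_ge.
rewrite -mulrA ler_wpM2l//.
apply: le_trans _ (ler_wpM2l (expR_ge0 _) (block_weight1_ge t)).
rewrite -expRD le_eqVlt; apply/orP; left; apply/eqP; congr expR; ring.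
Qed.

(* The tail [b * al_max * (theta ^+ k.+1 + theta ^+ k.+2 + ..)] of a geometric
   series. *)
Definition max_exponent k := b * (al_max / (1 - theta) * theta ^+ k.+1).

Lemma max_exponent_ge0 k : 0 <= max_exponent k.
Proof.
rewrite /max_exponent mulr_ge0 ?(ltW b_gt0)// mulr_ge0 ?exprn_ge0 ?(ltW theta_gt0)//.
by rewrite divr_ge0// subr_ge0 ltW.
Qed.

Lemma max_exponentB k :
  max_exponent k.+1 - max_exponent k = b * - (al_max * theta ^+ k.+1).
Proof.
rewrite /max_exponent [theta ^+ k.+2]exprSr; field.
by rewrite subr_eq0 eq_sym lt_eqF.
Qed.

Let thetan_ge0 k : 0 <= theta ^+ k. Proof. by rewrite exprn_ge0// ltW. Qed.

Lemma block_weight_ge_max j k : (1 <= j <= N)%N ->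
  p%:R * expR (max_exponent k.+1 - max_exponent k) <= block_weight j (theta ^+ k.+1).
Proof.
move=> j1N; rewrite max_exponentB; apply: block_weight_ge => // a.
exact: al_le_max.
Qed.

Lemma prod_block_weight_le j m n : (2 <= j <= N)%N ->
  \prod_(k < n.+1) block_weight j (theta ^+ k.+1) <=
  p%:R ^+ m.+1 * expR (b * - ((al (p + 1)%N - al 1%N) * theta)) *
    expR (max_exponent m.+1) * \prod_(k < n.+1) block_weight 1 (theta ^+ k.+1).
Proof.
move=> j2N; have j1N : (1 <= j <= N)%N by case/andP: j2N => /ltnW ->.
have le1 t : 0 <= t -> block_weight j t <= p%:R * block_weight 1 t.
  move=> t0; apply: le_trans (block_weight_le_block1 j2N t0) _.
  rewrite ler_wpM2r ?block_weight_ge0// ler_piMr// -expR0 ler_expR.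
  by rewrite mulrN oppr_le0 !mulr_ge0// ?ltW// subr_gt0.
apply: (@prod_ratio_le _ p (fun k => block_weight j (theta ^+ k.+1))
  (fun k => block_weight 1 (theta ^+ k.+1)) max_exponent); rewrite ?expR_ge0//.
- exact: max_exponent_ge0.
- by move=> k; exact: block_weight_ge0.
- by move=> k; exact: block_weight_ge0.
- by rewrite expr1; exact: block_weight_le_block1 (ltW theta_gt0).
- by move=> k; exact: le1.
(* The weight of block [j] is at most [p], and that of block 1 falls short of [p] by at most the
   exponential of an increment of [max_exponent]. *)
- move=> k; apply: le_trans (block_weight_le_card j1N (thetan_ge0 _)) _.
  rewrite -ler_pdivrMl ?expR_gt0// -expRN opprB mulrC.
  exact: block_weight_ge_max.
Qed.

(** * Masses of cylinders and exit sets under an eigenmeasure *)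

Variables (nu : probability (shift_space (letter N p)) R) (r : R).
Hypothesis eigen : forall phi : shift_space (letter N p) -> R, continuous phi ->
  \int[nu]_x transfer (fun x => b * potential theta alpha al x) phi x =
  r * \int[nu]_x phi x.

Local Notation mass j n := (stay_mass (block N p j) nu n).
Let last_mass := \int[nu]_x (x 0%N == ord_max :> letter N p)%:R.

Let last_continuous :
  continuous (fun x : shift_space (letter N p) => (x 0%N == ord_max)%:R : R).
Proof.
by apply: (@continuous_finite_dependence _ _ _ 0) => x y xy; rewrite xy.
Qed.

(** Each point has exactly one preimage in [u], where the potential is constant. This yields the
    positivity of [r] and of the mass of [u], and later the decay of the latter. *)
Lemma last_mass_eigen : r * last_mass = expR (- (b * alpha)).
Proof.
rewrite -eigen// -[RHS](Rintegral_prob_cst nu); apply: eq_Rintegral => x _.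
rewrite /transfer (bigD1 (ord_max : letter N p))//= big1 ?addr0 => [|a /negbTE am].
  by rewrite eqxx mulr1 /potential /= eqxx mulrN.
by rewrite am mulr0.
Qed.

Lemma eigenvalue_gt0 : 0 < r.
Proof.
have : 0 < r * last_mass by rewrite last_mass_eigen expR_gt0.
have : 0 <= last_mass by apply: Rintegral_ge0.
by rewrite le_eqVlt => /predU1P[<-|/pmulr_lgt0 ->//]; rewrite mulr0 ltxx.
Qed.

Lemma exit_mass_block j n : (1 <= j <= N)%N ->
  r * (mass j n.+1 - mass j n.+2) =
  block_weight j (theta ^+ n.+1) * (mass j n - mass j n.+1).
Proof.
move=> j1N; apply: (exit_mass_eigen eigen) => x xs xn.
by apply: eq_bigr => a aj; rewrite (potential_exit p_ge2 alpha al theta01 j1N aj xs xn).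
Qed.

Lemma last_mass_le : last_mass <= 1 - mass 1 1.
Proof.
rewrite -[X in _ <= X - _](stay_mass0 (block N p 1) nu) stay_massB.
apply: le_integral_continuous => // [|x].
  apply: (@continuous_finite_dependence _ _ _ 0) => x y xy.
  by rewrite xy.
rewrite ler_nat; case: eqP => //= ->.
by rewrite (mem_block p_ge2)//= mulnK// gtn_eqF// ltnW.
Qed.

Lemma eigenvalue_gt : p%:R < r.
Proof.
apply: (decr_ratio_gt _ eigenvalue_gt0 max_exponent_ge0 _ _
  (fun n => exit_mass_block n block1N) (fun k => block_weight_ge_max k block1N)).
- exact: p_gt0.
- exact: stay_mass_ge0.
(* The first exit mass is positive because [u] lies outside [A_1] and has positive mass. *)
- rewrite stay_mass0 -subr_gt0; apply: lt_le_trans last_mass_le.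
  by rewrite -(pmulr_rgt0 _ eigenvalue_gt0) last_mass_eigen expR_gt0.
Qed.

Lemma first_letter_cover :
  1 - mass 1 1 <= \sum_(2 <= j < N.+1) mass j 1 + last_mass.
Proof.
have csum : continuous (fun x : shift_space (letter N p) =>
    \sum_(2 <= j < N.+1) (stays (block N p j) 1 x)%:R : R).
  by apply: continuous_sum => j; exact: stays_continuous.
rewrite -integral_sum_continuous; last by move=> j; exact: stays_continuous.
rewrite -integralD_continuous//.
rewrite -[X in X - _](stay_mass0 (block N p 1) nu) stay_massB.
apply: le_integral_continuous => [||x].
- apply: (@continuous_finite_dependence _ _ _ 0) => x y xy.
  by rewrite xy.
- apply: (@continuous_finite_dependence _ _ _ 0) => x y xy.
  by rewrite xy//; congr (_ + _); apply: eq_bigr => j _; rewrite /stays /= xy.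
have s0 : 0 <= \sum_(2 <= j < N.+1) (stays (block N p j) 1 x)%:R :> R.
  by apply: sumr_ge0.
have [xl|[j /andP[j1 jN] xj]] := letter_cases p_ge2 (x 0%N).
  by rewrite xl eqxx; apply: ler_wpDl => //; rewrite ler_nat; exact: leq_b1.
case: (boolP (x 0%N \in _)) => [_|xn1]; first by rewrite addr_ge0.
have j2 : (2 <= j)%N.
  by rewrite ltn_neqAle j1 andbT; apply: contraNneq xn1 => ->.
rewrite (bigD1_seq j) /=; last 2 first.
- by rewrite mem_index_iota j2.
- exact: iota_uniq.
by rewrite {1}/stays /= xj /= -addrA lerDl addr_ge0// sumr_ge0.
Qed.

(** [first_letter_cover] is multiplied by [1 - mass 1 1]: by [mass_comparison] each later block
    contributes at most [eps], and [u] at most [r * last_mass], since [1 - mass 1 1 <= 1 <= r]. *)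
Lemma complement_mass_sqr m :
  (1 - mass 1 1) ^+ 2 <=
  N%:R * (p%:R ^+ m.+1 * expR (b * - ((al (p + 1)%N - al 1%N) * theta)) *
    expR (max_exponent m.+1)) + expR (- (b * alpha)).
Proof.
set eps := (X in N%:R * X).
have eps0 : 0 <= eps by rewrite !mulr_ge0 ?expR_ge0// exprn_ge0.
have r1 : 1 <= r by apply: le_trans (ltW eigenvalue_gt); rewrite ler1n; lia.
have mass_le1 j : mass j 1 <= 1.
  by rewrite -[leRHS](stay_mass0 (block N p j) nu) stay_massS_le.
have mass_prod j : (2 <= j <= N)%N -> (1 - mass 1 1) * mass j 1 <= eps.
  move=> j2N; have j1N : (1 <= j <= N)%N by case/andP: j2N => /ltnW ->.
  apply: (mass_comparison eps0 eigenvalue_gt _ _ _ _ _ _ _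
    (fun n => exit_mass_block n j1N) (fun n => exit_mass_block n block1N)).
  - exact: stay_mass0.
  - exact: stay_mass0.
  - exact: stay_mass_ge0.
  - exact: stay_mass_ge0.
  - exact: stay_massS_le.
  - exact: stay_massS_le.
  - move=> n; rewrite -[X in _ <= X%:R ^+ _](card_block p_ge2 j1N).
    apply: (stay_mass_le eigen); first exact: ltW eigenvalue_gt0.
    move=> a x aj; rewrite pmulr_rle0//.
    exact: potential_block_le0 j1N aj.
  - by move=> n; exact: block_weight_ge0.
  - by move=> n; exact: prod_block_weight_le.
have e0 : 0 <= 1 - mass 1 1 by rewrite subr_ge0.
rewrite expr2; apply: le_trans (ler_wpM2l e0 first_letter_cover) _.
rewrite mulrDr; apply: lerD.
  rewrite mulr_sumr; apply: (@le_trans _ _ (\sum_(2 <= j < N.+1) eps)).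
    rewrite big_nat_cond [leRHS]big_nat_cond; apply: ler_sum => j.
    by rewrite andbT ltnS => /mass_prod.
  rewrite sumr_const_nat -[leLHS]mulr_natl; apply: ler_wpM2r => //.
  by rewrite ler_nat; lia.
rewrite -last_mass_eigen; apply: ler_wpM2r; first exact: Rintegral_ge0.
by apply: le_trans r1; rewrite gerBl stay_mass_ge0.
Qed.

(** The exit masses of block 1 decrease, as its weights are at most [p < r], so each of the first
    [n] is at most the initial one. *)
Lemma complement_mass_le n : 1 - mass 1 n <= n%:R * (1 - mass 1 1).
Proof.
have mass_decr k : 0 <= mass 1 k - mass 1 k.+1.
  by rewrite subr_ge0 stay_massS_le.
have exit_le k : mass 1 k - mass 1 k.+1 <= 1 - mass 1 1.
  elim: k => [|k IHk]; first by rewrite stay_mass0.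
  apply: le_trans IHk; rewrite -(ler_pM2l eigenvalue_gt0) exit_mass_block//.
  rewrite ler_wpM2r//; apply: le_trans (ltW eigenvalue_gt).
  exact: block_weight_le_card.
elim: n => [|n IHn]; first by rewrite stay_mass0 subrr mul0r.
by rewrite -natr1 mulrDl mul1r; have := exit_le n; lra.
Qed.

Lemma integral_stays_block1_le n (phi : shift_space (letter N p) -> R) :
  continuous phi -> (forall x, 0 <= phi x) ->
  p%:R ^+ n * \int[nu]_x ((stays (block N p 1) n x)%:R * phi x) <=
  \int[nu]_x iter n (branch_sum (block N p 1)) phi x.
Proof.
move=> cphi phi0; apply: le_trans _
  (@integral_stays_le _ _ (block N p 1) _ _ _ eigen n _ _ _ cphi phi0).
- apply: ler_wpM2r; first by apply: Rintegral_ge0 => x _; rewrite mulr_ge0.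
  by rewrite lerXn2r ?nnegrE ?ler0n ?(ltW eigenvalue_gt0) ?(ltW eigenvalue_gt).
- exact: ltW eigenvalue_gt0.
- move=> a x aj; rewrite pmulr_rle0//; exact: potential_block_le0 block1N aj.
Qed.

End Weights.

End EigenMeasure.

(** * Convergence *)

Section Comparison.
Variables (R : realType) (T : alphabetType) (B : {set T}).
Variables nu eta : probability (shift_space T) R.
Hypothesis B_gt0 : (0 < #|B|)%N.
Hypothesis eta_eigen : forall phi : shift_space T -> R, continuous phi ->
  \int[eta]_x branch_sum B phi x = #|B|%:R * \int[eta]_x phi x.
Hypothesis nu_stays : forall n (phi : shift_space T -> R),
  continuous phi -> (forall x, 0 <= phi x) ->
  #|B|%:R ^+ n * \int[nu]_x ((stays B n x)%:R * phi x) <=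
  \int[nu]_x iter n (branch_sum B) phi x.
Implicit Types (phi : shift_space T -> R) (e K : R).

Let cardn_gt0 n : 0 < #|B|%:R ^+ n :> R.
Proof. by rewrite exprn_gt0// ltr0n. Qed.

Lemma integral_iter_branch_sum n phi : continuous phi ->
  \int[eta]_x iter n (branch_sum B) phi x = #|B|%:R ^+ n * \int[eta]_x phi x.
Proof.
move=> cphi; elim: n => [|n IHn]; first by rewrite mul1r.
by rewrite eta_eigen ?IHn ?exprS ?mulrA//; exact: iter_branch_sum_continuous.
Qed.

(** Divided by [#|B| ^ n], the iterate oscillates by at most [e] and has the same [eta]-integral as
    [phi]. *)
Lemma iter_branch_sum_le n phi e x : continuous phi ->
  (forall x y, (forall k, (k < n)%N -> y k = x k) -> `|phi x - phi y| <= e) ->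
  iter n (branch_sum B) phi x <= #|B|%:R ^+ n * (\int[eta]_x phi x + e).
Proof.
move=> cphi osc; have citer := (@iter_branch_sum_continuous _ _ B n _ cphi).
rewrite mulrDr -integral_iter_branch_sum//.
set c := _ * e; rewrite -lerBlDr -[leLHS](Rintegral_prob_cst eta).
apply: le_integral_continuous => // [|y]; first exact: cst_continuous.
have := iter_branch_sum_oscillation B osc x y.
rewrite mulrC -/c /=; move=> /ler_normlW; lra.
Qed.

(** The points that stay in [B] for [n] letters are controlled by [nu_stays] and
    [iter_branch_sum_le]; the others contribute at most [K] times their mass. *)
Lemma integral_le_extension n phi e K : continuous phi ->
  (forall x, 0 <= phi x <= K) ->
  (forall x y, (forall k, (k < n)%N -> y k = x k) -> `|phi x - phi y| <= e) ->
  \int[nu]_x phi x <= \int[eta]_x phi x + e + K * (1 - stay_mass B nu n).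
Proof.
move=> cphi phiK osc.
have phi0 x : 0 <= phi x by case/andP: (phiK x).
have cs := (@stays_mul_continuous _ _ B n _ cphi).
have c1 : continuous (fun x => K * (1 - (stays B n x)%:R : R)).
  apply: (@continuous_finite_dependence _ _ _ n) => x y xy.
  by rewrite (@eq_stays _ B n x y)// => k /ltnW/xy.
have -> : K * (1 - stay_mass B nu n) = \int[nu]_x (K * (1 - (stays B n x)%:R)).
  rewrite integralZ_continuous; last first.
    apply: (@continuous_finite_dependence _ _ _ n) => x y xy.
    by rewrite (@eq_stays _ B n x y)// => k /ltnW/xy.
  rewrite (@integralB_continuous _ _ nu (cst 1)) ?Rintegral_prob_cst//.
    exact: cst_continuous.
  exact: stays_continuous.
apply: (@le_trans _ _ (\int[nu]_x ((stays B n x)%:R * phi x) +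
    \int[nu]_x (K * (1 - (stays B n x)%:R)))).
  rewrite -integralD_continuous//; apply: le_integral_continuous => //.
    by move=> x; exact: (continuousD (cs x) (c1 x)).
  move=> x; have /andP[] := phiK x; case: stays => /=; lra.
rewrite lerD2r -(ler_pM2l (cardn_gt0 n)); apply: le_trans (nu_stays n cphi phi0) _.
rewrite -[leRHS](Rintegral_prob_cst nu).
apply: le_integral_continuous => [||x].
- exact: iter_branch_sum_continuous.
- exact: cst_continuous.
- exact: iter_branch_sum_le.
Qed.

Lemma integral_dist_le n phi e K : continuous phi ->
  (forall x, `|phi x| <= K) ->
  (forall x y, (forall k, (k < n)%N -> y k = x k) -> `|phi x - phi y| <= e) ->
  `|\int[eta]_x phi x - \int[nu]_x phi x| <= e + (K + K) * (1 - stay_mass B nu n).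
Proof.
move=> cphi phiK osc.
have cK : continuous (cst K : shift_space T -> R) by exact: cst_continuous.
have cD : continuous (fun x => K + phi x).
  by move=> x; exact: (continuousD (cK x) (cphi x)).
have cB : continuous (fun x => K - phi x).
  by move=> x; exact: (continuousB (cK x) (cphi x)).
have intD (m : probability (shift_space T) R) :
    \int[m]_x (K + phi x) = K + \int[m]_x phi x.
  by rewrite (integralD_continuous m cK cphi) Rintegral_prob_cst.
have intB (m : probability (shift_space T) R) :
    \int[m]_x (K - phi x) = K - \int[m]_x phi x.
  by rewrite (integralB_continuous m cK cphi) Rintegral_prob_cst.
have kb x : - K <= phi x <= K by rewrite -ler_norml.
(* The one-sided bound is applied to [K + phi] and [K - phi], with values between 0 and [K + K]. *)
have hD : K + \int[nu]_x phi x <=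
    K + \int[eta]_x phi x + e + (K + K) * (1 - stay_mass B nu n).
  rewrite -!intD; apply: integral_le_extension => // [x|x y /osc].
    by have := kb x; lra.
  by rewrite opprD addrACA subrr add0r.
have hB : K - \int[nu]_x phi x <=
    K - \int[eta]_x phi x + e + (K + K) * (1 - stay_mass B nu n).
  rewrite -!intB; apply: integral_le_extension => // [x|x y /osc].
    by have := kb x; lra.
  by rewrite (_ : K - phi x - (K - phi y) = phi y - phi x) 1?distrC//; ring.
rewrite ler_norml; apply/andP; split; lra.
Qed.

End Comparison.

(** * The eigenmeasure of the zero potential on the subshift *)

Section TopMeasure.
Variables (R : realType) (T : alphabetType) (B : {set T}).
Variables (B0 : B != finset.set0).
Variable m : probability (shift_space (subalphabet B0)) R.

Lemma integral_extend_measure (phi : shift_space T -> R) : continuous phi ->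
  \int[extend_measure m]_x phi x = \int[m]_x phi (inclusion x).
Proof.
move=> cphi; rewrite /Rintegral; congr fine.
apply: integral_distribution.
  by apply/measurable_realfun.measurable_EFinP; exact: continuous_measurable.
apply: (@continuous_integrable _ _ m (phi \o @inclusion T B B0)) => x.
by apply: continuous_comp; [exact: inclusion_continuous|exact: cphi].
Qed.

Hypothesis m_eigen : eigenprobability (fun=> 0) m.

Lemma extend_measure_eigen (phi : shift_space T -> R) : continuous phi ->
  \int[extend_measure m]_x branch_sum B phi x =
  #|B|%:R * \int[extend_measure m]_x phi x.
Proof.
have eigen (psi : shift_space T -> R) : continuous psi ->
    \int[extend_measure m]_x branch_sum B psi x =
    spectral_radius (fun _ : shift_space (subalphabet B0) => 0 : R) *
    \int[extend_measure m]_x psi x.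
  move=> cpsi; rewrite !integral_extend_measure//; last exact: branch_sum_continuous.
  rewrite -m_eigen; last first.
    by move=> x; apply: continuous_comp; [exact: inclusion_continuous|exact: cpsi].
  apply: eq_Rintegral => x _; rewrite /branch_sum /transfer expR0.
  under [RHS]eq_bigr do rewrite mul1r.
  by rewrite big_sub; apply: eq_bigr => a _; congr psi; apply/funext => -[].
(* Testing on the constant 1, whose branch sum is [#|B|], identifies the spectral radius. *)
suff -> : #|B|%:R = spectral_radius (fun _ : shift_space (subalphabet B0) => 0 : R).
  exact: eigen.
have := eigen (cst 1) (@cst_continuous _ _ _).
rewrite Rintegral_prob_cst mulr1 => <-.
rewrite -[LHS](Rintegral_prob_cst (extend_measure m)); apply: eq_Rintegral => x _.
by rewrite /branch_sum sumr_const.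
Qed.

End TopMeasure.

(** * Passage to the limit *)

Lemma expRN_small (R : realType) (c e : R) : 0 < c -> 0 < e ->
  \forall b \near +oo, expR (- (b * c)) <= e.
Proof.
move=> c0 e0; near=> b.
have bc : e^-1 <= b * c.
  by rewrite -ler_pdivrMr//; near: b; apply: nbhs_pinfty_ge; exact: num_real.
rewrite expRN -[leRHS]invrK lef_pV2 ?posrE ?expR_gt0 ?invr_gt0//.
by apply: le_trans bc _; apply: le_trans (expR_ge1Dx _); rewrite lerDr.
Unshelve. all: by end_near.
Qed.

Theorem theorem1 (R : realType) (N p : nat) (hN : (2 <= N)%N) (hp : (2 <= p)%N)
  (theta : R) (htheta : 0 < theta < 1)
  (alpha : R) (halpha : 0 < alpha)
  (al : nat -> R)
  (al_gt0 : forall k, (1 <= k <= N * p)%N -> 0 < al k)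
  (al_block_lt : forall j, (1 <= j <= N)%N ->
     al ((j - 1) * p + 1)%N < al ((j - 1) * p + 2)%N)
  (al_block_le : forall j i, (1 <= j <= N)%N -> (2 <= i < p)%N ->
     al ((j - 1) * p + i)%N <= al ((j - 1) * p + i.+1)%N)
  (al_first_lt1 : al 1%N < al (p + 1)%N)
  (al_first_lt2 : (2 < N)%N -> al (p + 1)%N < al (2 * p + 1)%N)
  (al_first_le : forall j, (2 <= j)%N -> (j.+1 < N)%N ->
     al (j * p + 1)%N <= al (j.+1 * p + 1)%N)
  (nu : R -> probability (shift_space (letter N p)) R)
  (hnu : forall beta : R, 0 < beta ->
     eigenprobability (fun x => beta * potential theta alpha al x) (nu beta))
  (nu_top : probability (shift_space (letter1 hN hp)) R)
  (hnu_top : eigenprobability (fun=> 0) nu_top) :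
  weak_star_cvg nu (extend_measure nu_top).
Proof.
have /andP[t0 t1] := htheta.
have block1N : (1 <= 1 <= N)%N by rewrite /= ltnW.
pose B := block N p 1.
have cardB : #|B| = p by exact: card_block.
pose delta := (al (p + 1)%N - al 1%N) * theta.
have delta0 : 0 < delta by rewrite mulr_gt0 ?subr_gt0.
(* Half of the gain [b * delta] pays for [max_exponent]; the other half makes the bound tend to
   0. *)
have deltaE b : b * - delta = - (b * (delta / 2)) - b * (delta / 2) by field.
(* [max_exponent] is linear in [b], so one [k] serves all [b]. *)
have [k kP] : exists k, forall b, 0 < b ->
    max_exponent N p theta al b k.+1 <= b * (delta / 2).
  pose D := (\sum_(k < N * p) al k.+1) / (1 - theta).
  have D0 : 0 <= D.
    rewrite divr_ge0 ?subr_ge0 ?(ltW t1)//; apply: sumr_ge0 => i _.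
    by apply/ltW/al_gt0; rewrite /= ltn_ord.
  have : theta ^+ n @[n --> \oo] --> (0 : R).
    by apply: cvg_expr; rewrite gtr0_norm.
  have s0 : 0 < delta / 2 / (D + 1) by rewrite !divr_gt0// ltr_wpDl.
  move=> /cvgrPdist_le /(_ _ s0) [n _ /(_ n.+2 (leq_trans (leqnSn n) (leqnSn _)))].
  rewrite sub0r normrN ger0_norm ?exprn_ge0 ?(ltW t0)// => ne.
  exists n => b b0; rewrite /max_exponent ler_wpM2l ?(ltW b0)// -/D.
  move: ne; rewrite ler_pdivlMr ?ltr_wpDl// => /(le_trans _); apply.
  by rewrite mulrC ler_wpM2l ?exprn_ge0 ?(ltW t0)// lerDl.
(* Both terms of [complement_mass_sqr] are made at most [s ^+ 2 / 2]; the 1 added to [K] keeps a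
   denominator positive. *)
have mass1_cvg s : 0 < s ->
    \forall b \near +oo, 1 - stay_mass B (nu b) 1 <= s.
  move=> s0; pose K : R := N%:R * p%:R ^+ k.+1.
  have K0 : 0 <= K by rewrite mulr_ge0 ?exprn_ge0 ?ler0n.
  have s20 : 0 < s ^+ 2 / 2 by rewrite divr_gt0 ?exprn_gt0.
  near=> b.
  have b0 : 0 < b by near: b; apply: nbhs_pinfty_gt; exact: num_real.
  have h := complement_mass_sqr hN hp htheta al_gt0 al_block_lt
    al_block_le al_first_lt1 al_first_lt2 al_first_le b0 (hnu b b0) k.
  have e1 : expR (- (b * alpha)) <= s ^+ 2 / 2.
    by near: b; exact: expRN_small.
  have e2 : expR (- (b * (delta / 2))) <= s ^+ 2 / 2 / (K + 1).
    near: b; apply: expRN_small; first by rewrite divr_gt0.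
    by rewrite divr_gt0// ltr_wpDl.
  have e3 : expR (b * - delta) * expR (max_exponent N p theta al b k.+1) <=
      expR (- (b * (delta / 2))).
    by rewrite -expRD ler_expR deltaE; have := kP b b0; lra.
  have e4 : K * expR (- (b * (delta / 2))) <= s ^+ 2 / 2.
    move: e2; rewrite ler_pdivlMr ?ltr_wpDl// => /(le_trans _); apply.
    by rewrite mulrC ler_wpM2l ?expR_ge0// lerDl.
  have mass_ge0 : 0 <= 1 - stay_mass B (nu b) 1.
    by rewrite subr_ge0 -[leRHS](stay_mass0 B (nu b)) stay_massS_le.
  rewrite -(@ler_pXn2r _ 2)// ?nnegrE ?(ltW s0)//.
  apply: le_trans h _; rewrite [leRHS]splitr; apply: lerD => //.
  by apply: le_trans e4; rewrite -[p%:R ^+ _ * _ * _]mulrA [leLHS]mulrA ler_wpM2l.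
move=> phi cphi; apply/cvgrPdist_le => e e0.
have [n osc] := uniform_continuity cphi (divr_gt0 e0 (ltr0Sn _ 1)).
have [K phiK] := continuous_bounded cphi.
have K0 : 0 <= K by apply: le_trans (phiK point).
have c0 : 0 < (K + K) * n%:R + 1 by rewrite ltr_wpDl// mulr_ge0 ?addr_ge0.
near=> b.
have b0 : 0 < b by near: b; apply: nbhs_pinfty_gt; exact: num_real.
(* Half of [e] covers the oscillation of [phi], which fixes [n]; the other half covers the mass
   leaving the block within [n] letters. *)
have mass1 : 1 - stay_mass B (nu b) 1 <= e / 2 / ((K + K) * n%:R + 1).
  by near: b; apply: mass1_cvg; rewrite !divr_gt0.
apply: le_trans (@integral_dist_le _ _ B (nu b) (extend_measure nu_top)
  _ _ _ n phi _ K cphi phiK osc) _.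
- by rewrite cardB; lia.
- exact: extend_measure_eigen.
- move=> i psi cpsi psi0; rewrite cardB.
  exact: (integral_stays_block1_le hN hp htheta al_gt0 b0 (hnu b b0)).
- have massn := complement_mass_le hN hp htheta al_gt0 b0 (hnu b b0) n.
  rewrite [leRHS]splitr lerD2l.
  apply: (@le_trans _ _ ((K + K) * n%:R * (1 - stay_mass B (nu b) 1))).
    by rewrite -mulrA ler_wpM2l// addr_ge0.
  have mass_ge0 : 0 <= 1 - stay_mass B (nu b) 1.
    by rewrite subr_ge0 -[leRHS](stay_mass0 B (nu b)) stay_massS_le.
  move: mass1; rewrite ler_pdivlMr// => /(le_trans _); apply.
  by rewrite mulrC ler_wpM2l// lerDl.
Unshelve. all: by end_near.
Qed.
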